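(* Let $F_s>0$, $N\ge2$, and for $k=1,\dots,K$ let $z_k=e^{-d_k}e^{2\pi i f_k/F_s}$ with $d_k\ge0$ and $f_k\in[0,F_s)$. Let $\delta\triangleq\min_{n\in\mathbb{Z}}\min_{1\le k,\ell\le K,\,k\ne\ell}|f_k-f_\ell+nF_s|$ and $d_{\max}\triangleq\max_{1\le k\le K}d_k$. Let $\mathbf V_N\in\mathbb{C}^{N\times K}$ be the Vandermonde matrix with entries $(\mathbf V_N)_{\ell k}=z_k^{\ell-1}$, $\ell=1,\dots,N$, $k=1,\dots,K$. If $d_{\max}<1/(N-1)$ and \[\delta>\frac{84F_s}{\pi(N-1)\bigl(1-d_{\max}(N-1)\bigr)},\] then \[\sigma_{\min}^2(\mathbf V_N)\ge(N-1)\bigl(1-d_{\max}(N-1)\bigr)-\frac{84F_s}{\pi\delta},\qquad \sigma_{\max}^2(\mathbf V_N)\le N-1+\frac{84F_s}{\pi\delta},\] and consequently \[\kappa(\mathbf V_N)\le\sqrt{\frac{N-1+84F_s/(\pi\delta)}{(N-1)\bigl(1-d_{\max}(N-1)\bigr)-84F_s/(\pi\delta)}}.\]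
   Context: $\sigma_{\min}(\mathbf A),\sigma_{\max}(\mathbf A)$ denote the smallest and largest singular values of $\mathbf A$, and $\kappa(\mathbf A)=\sigma_{\max}(\mathbf A)/\sigma_{\min}(\mathbf A)$ is its condition number. *)

(* Defs.v *)
From HB Require Import structures.
From mathcomp Require Import all_boot all_order all_algebra.
From mathcomp Require Import complex.
From mathcomp Require Import boolp classical_sets reals.
From mathcomp.analysis Require Import sequences exp trigo.
Set Implicit Arguments. Unset Strict Implicit. Unset Printing Implicit Defensive.
Import Order.TTheory GRing.Theory Num.Theory.
Local Open Scope ring_scope.
Local Open Scope classical_set_scope.

Section Defs.
Variable R : realType.

Definition node (Fs d f : R) : R[i] :=
  Complex (expR (- d) * cos (2 * pi * f / Fs)) (expR (- d) * sin (2 * pi * f / Fs)).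

(* (V_N)_{l k} = z_k^{l-1}, with 0-based row index l *)
Definition vandermonde (N K : nat) (z : 'I_K -> R[i]) : 'M[R[i]]_(N, K) :=
  \matrix_(l < N, k < K) (z k) ^+ l.

Definition adjmx (m n : nat) (A : 'M[R[i]]_(m, n)) : 'M[R[i]]_(n, m) :=
  map_mx (@conjc R) A^T.

(* squared singular values of A : 'M_(m,n): eigenvalues of A^H A if n <= m,
   of A A^H otherwise (the min(m,n) singular values); these Hermitian PSD
   matrices have only real eigenvalues. *)
Definition sq_singular_values (m n : nat) (A : 'M[R[i]]_(m, n)) : set R :=
  if (n <= m)%N then [set lam : R | eigenvalue (adjmx A *m A) (lam%:C)%C]
  else [set lam : R | eigenvalue (A *m adjmx A) (lam%:C)%C].

Definition sigma_min (m n : nat) (A : 'M[R[i]]_(m, n)) : R :=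
  Num.sqrt (inf (sq_singular_values A)).
Definition sigma_max (m n : nat) (A : 'M[R[i]]_(m, n)) : R :=
  Num.sqrt (sup (sq_singular_values A)).
Definition cond_number (m n : nat) (A : 'M[R[i]]_(m, n)) : R :=
  sigma_max A / sigma_min A.

Definition min_sep (K : nat) (Fs : R) (f : 'I_K -> R) : R :=
  inf [set x : R | exists (k l : 'I_K) (n : int),
                     k != l /\ x = `|f k - f l + n%:~R * Fs|].

Definition dmax (K : nat) (d : 'I_K -> R) : R := \big[Num.max/0]_(k < K) d k.
End Defs.

(* Main.v *)
(** Averaging shifted blocks of rows: for [u = z_k conj(z_j)],
    [sum_(h < H) sum_(m < M) u ^ (h + m) = (1 - u^H) (1 - u^M) / (1 - u)^2],
    so the off-diagonal entries of the averaged Gram matrix decay quadratically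
    in the wrap-around distance of the frequencies, and Schur's test applies to
    a convergent sum, with no logarithmic loss.  With [H] about [Fs / delta],
    blocks of length [N - H + 1] inside [[0, N)] give the lower bound, and blocks
    of length [N + H - 1] covering [[0, N)] give the upper bound, after replacing
    [x_k] by [x_k / z_k^(H-1)] to avoid negative powers; as [d_max (N - 1) < 1],
    this costs a factor [1 + O(H / N)].  All error terms together stay below
    [21 Fs / delta], and [84 / pi > 21]. *)
Require Import Defs.
From HB Require Import structures.
From mathcomp Require Import all_boot all_order all_algebra.
From mathcomp Require Import complex.
From mathcomp Require Import boolp classical_sets reals.
From mathcomp.analysis Require Import sequences exp trigo.
From mathcomp Require Import ring lra zify.
From mathcomp.analysis Require Import topology normedtype derive.
Import Order.TTheory GRing.Theory Num.Theory.
Import numFieldNormedType.Exports.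
Local Open Scope ring_scope.

(** * Scalar estimates: inverse squares and the cosine *)

Lemma sum_invr_sqr_le2 (R : realFieldType) (n : nat) :
  \sum_(m < n) (m.+1%:R ^+ 2)^-1 <= 2 :> R.
Proof.
(* [1/(m+1)^2 <= 1/(m+1/2) - 1/(m+3/2)] makes the bound telescope. *)
suff H : \sum_(m < n) (m.+1%:R ^+ 2)^-1 <= 2 - (n%:R + 1 / 2)^-1 :> R.
  apply: le_trans H _; rewrite gerBl invr_ge0.
  by apply: addr_ge0; rewrite ?ler0n //; lra.
elim: n => [|n IH]; first by rewrite big_ord0 add0r div1r invrK subrr.
rewrite big_ord_recr /=; apply: le_trans (lerD IH (lexx _)) _.
have n0 : 0 <= n%:R :> R by rewrite ler0n.
rewrite -(natr1 n); move: n0; set x : R := n%:R => n0.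
rewrite -subr_ge0.
have -> : 2 - (x + 1 + 1 / 2)^-1 - (2 - (x + 1 / 2)^-1 + ((x + 1) ^+ 2)^-1) =
    ((x + 1 / 2) * (x + 1 + 1 / 2) * (x + 1) ^+ 2 * 4)^-1.
  by field; repeat (apply/andP; split); lra.
by rewrite invr_ge0 !mulr_ge0 ?exprn_ge0 //; lra.
Qed.

(** Up to [t = 1/4], [cos (2 pi t) = 1 - 2 sin^2 (pi t)], and the mean value theorem with
    [cos c >= cos (pi / 4)] and [pi >= 2] gives [sin^2 (pi t) >= 2 t^2]; beyond, the cosine is
    nonpositive and the right side nonnegative. *)
Lemma cos_le_quadratic (R : realType) (t : R) :
  `|t| <= 1 / 2 -> cos (2 * pi * t) <= 1 - 4 * t ^+ 2.
Proof.
wlog t0 : t / 0 <= t => [H|].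
  case: (lerP 0 t) => [/H //|t0 ht].
  by have := H (- t); rewrite normrN mulrN cosN sqrrN; apply => //; lra.
rewrite ger0_norm // => t2.
have p2 := @pi_ge2 R.
have c2 : 2 * pi * t = (pi * t) *+ 2 by rewrite -mulr_natl; ring.
case: (lerP t (1/4)) => t4; last first.
  rewrite c2.
  have c0 : cos (2 * pi * t) <= 0.
    have -> : 2 * pi * t = (2 * pi * t - pi / 2) + pi / 2 by ring.
    rewrite cosDpihalf oppr_le0 sin_ge0_pi //.
    by apply/andP; split; nra.
  rewrite -c2; nra.
have cq : cos (pi / 4) ^+ 2 = 1 / 2 :> R.
  have := cos_mulr2n (pi / 4 : R).
  have -> : (pi / 4) *+ 2 = pi / 2 :> R by rewrite -mulr_natl; field.
  by rewrite cos_pihalf -mulr_natl => h; lra.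
have [c ci e] : exists2 c, c \in `[0, pi * t] & sin (pi * t) - sin 0 = cos c * (pi * t - 0).
  apply: (@MVT_segment R sin cos) => //; first by nra.
  by apply/continuous_subspaceT => x; exact: continuous_sin.
rewrite sin0 !subr0 in e.
move: ci; rewrite in_itv /= => /andP[c0 cl].
have cc : cos (pi / 4) <= cos c.
  rewrite leNgt ltr_cos ?in_itv /=; last 2 first.
  - by apply/andP; split; nra.
  - by apply/andP; split; nra.
  by rewrite -leNgt; nra.
have cq0 : 0 <= cos (pi / 4 : R).
  by apply: cos_ge0_pihalf; apply/andP; split; nra.
have c12 : 1 / 2 <= cos c ^+ 2 by rewrite -cq; apply: lerXn2r => //; rewrite nnegrE //; lra.
rewrite c2 cos_mulr2n cos2sin2 e -mulr_natl.
have : 2 * t ^+ 2 <= (cos c * (pi * t)) ^+ 2.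
  rewrite exprMn.
  apply: le_trans (_ : 1/2 * (pi * t)^+2 <= _); last by rewrite ler_wpM2r ?sqr_ge0.
  rewrite exprMn; have : 4 <= pi ^+ 2 :> R by nra.
  by move=> p4; have := sqr_ge0 t; nra.
lra.
Qed.

(** For [u] of modulus [r] whose argument has cosine [c], the right side is [|1 - u|^2]: the angle
    alone forces a gap, whatever the damping. *)
Lemma one_sub_polar_sqr_ge (R : realType) (r c t : R) :
  0 <= r <= 1 -> c <= 1 - 4 * t ^+ 2 -> -1 <= c -> 2 * t ^+ 2 <= 1 - 2 * r * c + r ^+ 2.
Proof.
move=> /andP[r0 r1] ct c1; apply: le_trans (_ : (1 - c) / 2 <= _); first lra.
(* For [c >= 0] the minimum over [r] is [1 - c^2 = (1 - c)(1 + c)], at [r = c]. *)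
case: (lerP 0 c) => c0; last nra.
have := sqr_ge0 (r - c); have := sqr_ge0 t; nra.
Qed.

(* [i |-> floor (t i / dl)] is injective on a [dl]-separated family, which reduces
   the sum to that of the inverse squares of distinct positive integers. *)
Lemma sum_invr_sqr_separated (R : realType) (I : finType) (P : pred I) (t : I -> R) (dl : R) :
  0 < dl -> (forall i, P i -> dl <= t i) ->
  (forall i j, P i -> P j -> i != j -> dl <= `|t i - t j|) ->
  \sum_(i | P i) (t i ^+ 2)^-1 <= 2 / dl ^+ 2.
Proof.
move=> dl0 tge tsep.
pose m i := Num.truncn (t i / dl).
have mP i : P i -> (0 < m i)%N /\ (m i)%:R * dl <= t i < (m i)%:R * dl + dl.
  move=> Pi; have q1 : 1 <= t i / dl by rewrite ler_pdivlMr // mul1r tge.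
  have q0 : 0 <= t i / dl by lra.
  split; first by rewrite truncn_gt0.
  have := truncn_itv q0; rewrite -/(m i) -natr1 ler_pdivlMr // ltr_pdivrMr //.
  by rewrite mulrDl mul1r.
have minj : {in P &, injective m}.
  move=> i j Pi Pj e; apply/eqP/negPn/negP => /(tsep _ _ Pi Pj).
  have [_ /andP[a1 a2]] := mP i Pi; have [_ /andP[b1 b2]] := mP j Pj.
  rewrite e in a1 a2; apply/negP; rewrite -ltNge ltr_norml; apply/andP; split; lra.
pose L := (\max_(i | P i) m i).+1.
have mL i : P i -> (m i < L)%N by move=> Pi; rewrite ltnS; apply: leq_bigmax_cond.
have h i : P i -> (t i ^+ 2)^-1 <= ((m i)%:R ^+ 2)^-1 / dl ^+ 2.
  move=> Pi; have [m0 /andP[a1 _]] := mP i Pi.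
  have t0 : 0 < t i by apply: lt_le_trans (tge i Pi).
  rewrite -invfM -exprMn lef_pV2 ?posrE ?exprn_gt0 ?mulr_gt0 ?ltr0n //.
  by apply: lerXn2r => //; rewrite nnegrE ?ltW ?mulr_gt0 ?ltr0n.
apply: le_trans (ler_sum _ h) _; rewrite -mulr_suml ler_wpM2r //.
  by rewrite invr_ge0 sqr_ge0.
apply: le_trans (sum_invr_sqr_le2 R L).
have pK i : P i -> (inord (m i).-1 : 'I_L) = (m i).-1 :> nat.
  by move=> Pi; rewrite inordK //; apply: leq_ltn_trans (leq_pred _) (mL i Pi).
rewrite (eq_bigr (fun i => ((inord (m i).-1 : 'I_L).+1%:R ^+ 2)^-1)); last first.
  by move=> i Pi; rewrite pK // prednK //; case: (mP i Pi).
rewrite -(@big_imset _ _ _ _ _ (fun i => inord (m i).-1 : 'I_L) P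
  (fun k => (k.+1%:R ^+ 2)^-1)) /=; last first.
  move=> i j Pi Pj /(congr1 (fun k : 'I_L => k.+1)).
  rewrite !pK // !prednK; [|by case: (mP j Pj)|by case: (mP i Pi)].
  exact: minj.
rewrite [leRHS](bigID (mem [set inord (m i).-1 | i in P])) /= lerDl.
by apply: sumr_ge0 => k _; rewrite invr_ge0 sqr_ge0.
Qed.

(** * Schur's test and averaged exponential sums *)

(** [|x i| |x j| <= (|x i|^2 + |x j|^2) / 2] splits the form in two; the symmetry of [a] makes the
    halves equal, and each is controlled by row sums. *)
Lemma schur_bound (C : numClosedFieldType) (I : finType) (A : I -> I -> C)
    (a : I -> I -> C) (B : C) (x : I -> C) :
  (forall i j, i != j -> `|A i j| <= a i j) -> (forall i j, a i j = a j i) ->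
  (forall i, \sum_(j | j != i) a i j <= B) ->
  `|\sum_i \sum_(j | j != i) x i * (x j)^* * A i j| <= B * \sum_i `|x i| ^+ 2.
Proof.
move=> Aa asym rowB.
have a0 i j : j != i -> 0 <= a i j.
  by move=> ij; apply: le_trans (Aa i j _); rewrite ?normr_ge0 // eq_sym.
have two0 : (0 : C) < 2 by rewrite ltr0n.
apply: (@le_trans _ _ (\sum_i \sum_(j | j != i)
  (`|x i| ^+ 2 / 2 * a i j + `|x j| ^+ 2 / 2 * a i j))).
  apply: le_trans (ler_norm_sum _ _ _) _; apply: ler_sum => i _.
  apply: le_trans (ler_norm_sum _ _ _) _; apply: ler_sum => j ij.
  rewrite !normrM norm_conjC -mulrDl.
  apply: ler_pM => //; first by rewrite mulr_ge0.
    rewrite -mulrDl ler_pdivlMr // -subr_ge0.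
    have -> : `|x i| ^+ 2 + `|x j| ^+ 2 - `|x i| * `|x j| * 2 = (`|x i| - `|x j|) ^+ 2 by ring.
    by rewrite real_exprn_even_ge0 // rpredB // normr_real.
  by rewrite Aa // eq_sym.
under eq_bigr do rewrite big_split /=.
rewrite big_split /= [X in _ + X](exchange_big_dep xpredT) //=.
rewrite [X in _ + X](_ : _ = \sum_i \sum_(j | j != i) `|x i| ^+ 2 / 2 * a i j); last first.
  by apply: eq_bigr => i _; apply: eq_big => [j|j _]; rewrite ?(asym j i) // eq_sym.
rewrite -big_split mulr_sumr /=; apply: ler_sum => i _.
rewrite -mulr_sumr -mulrDl -splitr mulrC ler_wpM2r // exprn_ge0 //.
Qed.

(** Entry [l] of the Vandermonde matrix applied to [x], for every [l], since blocks may run past row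
    [N]. *)
Definition expsum {C : numClosedFieldType} {K : nat} (z x : 'I_K -> C) (l : nat) : C :=
  \sum_k x k * z k ^+ l.

Lemma normC_expsum_sqr (C : numClosedFieldType) (K : nat) (z x : 'I_K -> C) (l : nat) :
  `|expsum z x l| ^+ 2 =
  \sum_k \sum_j x k * (x j)^* * (z k * (z j)^*) ^+ l.
Proof.
rewrite normCK /expsum rmorph_sum mulr_suml; apply: eq_bigr => k _.
rewrite mulr_sumr; apply: eq_bigr => j _.
by rewrite rmorphM rmorphXn exprMn; ring.
Qed.

Lemma sum_expsum_blocks (C : numClosedFieldType) (K H M : nat) (z x : 'I_K -> C) :
  \sum_(h < H) \sum_(m < M) `|expsum z x (h + m)| ^+ 2 =
  \sum_k \sum_j x k * (x j)^* *
    ((\sum_(h < H) (z k * (z j)^*) ^+ h) * (\sum_(m < M) (z k * (z j)^*) ^+ m)).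
Proof.
under eq_bigr do under eq_bigr do rewrite normC_expsum_sqr.
under eq_bigr do rewrite exchange_big /=.
rewrite exchange_big /=; apply: eq_bigr => k _.
under eq_bigr do rewrite exchange_big /=.
rewrite exchange_big /=; apply: eq_bigr => j _.
rewrite mulr_suml mulr_sumr; apply: eq_bigr => h _.
rewrite !mulr_sumr; apply: eq_bigr => m _.
by rewrite exprD.
Qed.

Lemma norm_geometric_sum_le (C : numClosedFieldType) (u : C) (n : nat) :
  `|u| <= 1 -> u != 1 -> `|\sum_(i < n) u ^+ i| <= 2 / `|1 - u|.
Proof.
move=> u1 un1.
have d0 : 0 < `|1 - u| by rewrite normr_gt0 subr_eq0 eq_sym.
rewrite ler_pdivlMr // -normrM.
have -> : (\sum_(i < n) u ^+ i) * (1 - u) = 1 - u ^+ n.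
  by rewrite mulrC -opprB mulNr -subrX1 opprB.
apply: le_trans (ler_normB _ _) _; rewrite normr1 normrX.
by rewrite -[2]/(1 + 1) lerD2l exprn_ile1.
Qed.

(** The diagonal is kept exactly. Off it, with [u = z_k conj(z_j)], each geometric sum is at most
    [2 / |1 - u|] whatever its length, whence the weights [4 / |1 - u|^2] in Schur's test. *)
Lemma sum_expsum_blocks_close (C : numClosedFieldType) (K H M : nat)
    (z x : 'I_K -> C) (B : C) :
  (forall k, `|z k| <= 1) -> (forall k j, k != j -> z k * (z j)^* != 1) ->
  (forall k, \sum_(j | j != k) 4 / `|1 - z k * (z j)^*| ^+ 2 <= B) ->
  `|\sum_(h < H) \sum_(m < M) `|expsum z x (h + m)| ^+ 2 -
    \sum_k `|x k| ^+ 2 *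
      ((\sum_(h < H) (`|z k| ^+ 2) ^+ h) * (\sum_(m < M) (`|z k| ^+ 2) ^+ m))| <=
  B * \sum_k `|x k| ^+ 2.
Proof.
move=> z1 zn rowB; rewrite sum_expsum_blocks -sumrB.
under eq_bigr => k _ do rewrite (bigD1 k) //= -!normCK [_ + _ - _]addrAC subrr add0r.
apply: (schur_bound C _ _ (fun k j => 4 / `|1 - z k * (z j)^*| ^+ 2)) => //.
- move=> k j kj.
  have u1 : `|z k * (z j)^*| <= 1 by rewrite normrM norm_conjC mulr_ile1.
  have -> : 4 / `|1 - z k * (z j)^*| ^+ 2 =
     (2 / `|1 - z k * (z j)^*|) * (2 / `|1 - z k * (z j)^*|) :> C.
    by rewrite mulf_div -natrM expr2.
  by rewrite normrM ler_pM ?normr_ge0 // norm_geometric_sum_le // zn.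
(* Exchanging [k] and [j] conjugates [1 - u], so the weights are symmetric. *)
- move=> k j; congr (_ / _ ^+ 2).
  by rewrite -norm_conjC rmorphB rmorphM rmorph1 /= conjCK mulrC.
Qed.

(** * Block sums and products of geometric sums *)

Lemma ler_sum_shift (C : numDomainType) (F : nat -> C) (h M N : nat) :
  (forall l, 0 <= F l) -> (h + M <= N)%N ->
  \sum_(m < M) F (h + m)%N <= \sum_(l < N) F l.
Proof.
move=> F0 hMN.
have -> : \sum_(m < M) F (h + m)%N = \sum_(h <= l < h + M) F l.
  rewrite -{2}[h]add0n big_addn addKn big_mkord.
  by apply: eq_bigr => m _; rewrite addnC.
rewrite -(big_mkord xpredT F) (@big_cat_nat _ _ _ h 0 N) //=; last lia.
rewrite (@big_cat_nat _ _ _ (h + M)%N h N) //=; last lia.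
by rewrite addrCA lerDl addr_ge0 // sumr_ge0.
Qed.

Lemma sum_affine (R : realFieldType) (a b : R) (M : nat) :
  \sum_(m < M) (a - b * m%:R) = M%:R * (a - b * (M%:R - 1) / 2).
Proof.
elim: M => [|M IH]; first by rewrite big_ord0 mul0r.
by rewrite big_ord_recr /= IH -(natr1 M); field.
Qed.

(** The hypothesis is applied to each [r ^+ (h + m)]; the mean of [h + m] over the rectangle is
    [(H + M - 2) / 2]. *)
Lemma geometric_product_ge (R : realFieldType) (r s : R) (H M : nat) :
  (forall n, 1 - s * n%:R <= r ^+ n) ->
  H%:R * M%:R * (1 - s * (H%:R + M%:R - 2) / 2) <=
  (\sum_(h < H) r ^+ h) * (\sum_(m < M) r ^+ m).
Proof.
move=> rn; rewrite mulr_suml.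
under eq_bigr do rewrite mulr_sumr.
have -> : H%:R * M%:R * (1 - s * (H%:R + M%:R - 2) / 2) =
   \sum_(h < H) \sum_(m < M) (1 - s * h%:R - s * m%:R).
  under eq_bigr do rewrite sum_affine.
  rewrite -mulr_sumr.
  rewrite (eq_bigr (fun h : 'I_H => (1 - s * (M%:R - 1) / 2) - s * h%:R)); last first.
    by move=> h _; ring.
  by rewrite sum_affine; field.
apply: ler_sum => h _; apply: ler_sum => m _.
by rewrite -exprD; apply: le_trans (rn _); rewrite natrD; lra.
Qed.

(** * Moduli of the nodes and of [1 - z_k conj(z_j)] *)

Section Nodes.
Variables (R : realType) (Fs : R).

Lemma sqr_normc_node (d f : R) :
  `|node Fs d f| ^+ 2 = (expR (- (2 * d)))%:C%C.
Proof.
rewrite -add_Re2_Im2 /= !exprMn -mulrDr cos2Dsin2 mulr1.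
by rewrite -expRM_natl mulrN.
Qed.

Lemma norm_node_le1 (d f : R) : 0 <= d -> `|node Fs d f| <= 1.
Proof.
move=> d0; rewrite -(@expr_le1 _ 2) // sqr_normc_node.
by rewrite -[leRHS](rmorph1 (real_complex R)) lecR expR_le1; lra.
Qed.

Lemma node_neq0 (d f : R) : node Fs d f != 0.
Proof.
rewrite -normr_eq0 -sqrf_eq0 sqr_normc_node.
by rewrite -[0](rmorph0 (real_complex R)) (inj_eq (@complexI R)) gt_eqF ?expR_gt0.
Qed.

Lemma sqr_norm_one_sub_node (d f e g : R) :
  `|1 - node Fs d f * (node Fs e g)^*| ^+ 2 =
  (1 - 2 * expR (- (d + e)) * cos (2 * pi * ((f - g) / Fs)) + expR (- (d + e)) ^+ 2)%:C%C.
Proof.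
rewrite -add_Re2_Im2 /=; congr (_%:C)%C.
have -> : 2 * pi * ((f - g) / Fs) = 2 * pi * f / Fs - 2 * pi * g / Fs by ring.
rewrite cosB (opprD d e) expRD.
set a := expR (- d); set b := expR (- e).
set cf := cos _; set sf := sin _; set cg := cos _; set sg := sin _.
have h1 : cf ^+ 2 + sf ^+ 2 = 1 by exact: cos2Dsin2.
have h2 : cg ^+ 2 + sg ^+ 2 = 1 by exact: cos2Dsin2.
(* Once both Pythagorean identities enter as factors, the claim is a polynomial identity. *)
have -> : (a * b) ^+ 2 = (a * b) ^+ 2 * (cf ^+ 2 + sf ^+ 2) * (cg ^+ 2 + sg ^+ 2).
  by rewrite h1 h2 !mulr1.
ring.
Qed.

Lemma cosD2pi_int (x : R) (n : int) : cos (x + 2 * pi * n%:~R) = cos x.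
Proof.
wlog [m ->] : x n / exists m : nat, n = m%:Z => [hw|].
  case: n => m; first by apply: hw; exists m.
  rewrite -[in RHS](subrK (2 * pi * m.+1%:R) x) (hw _ m.+1); last by exists m.+1.
  by rewrite NegzE mulrNz mulrN.
have -> : 2 * pi * m%:Z%:~R = (pi *+ 2) *+ m :> R.
  by rewrite -[RHS]mulr_natr -[pi *+ 2]mulr_natl.
exact: (periodicn (@cosD2pi R)).
Qed.

End Nodes.

Lemma mul_natr_sum (C : nzRingType) (n : nat) (a : C) : n%:R * a = \sum_(i < n) a.
Proof. by rewrite sumr_const card_ord mulr_natl. Qed.

(** * Frame bounds for separated nodes *)

Section Frame.
Variables (R : realType) (Fs dl : R) (K : nat) (d f : 'I_K -> R).
Hypotheses (d_ge0 : forall k, 0 <= d k) (dl_gt0 : 0 < dl).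
Hypothesis sep : forall (k j : 'I_K) (n : int),
  k != j -> dl <= `|(f k - f j) / Fs + n%:~R|.

Local Notation z := (fun k => node Fs (d k) (f k)).

(** The representative of [y] modulo 1 in [[-1/2, 1/2)]; its absolute value is the distance to the
    nearest integer. *)
Definition wrap (y : R) : R := y - (Num.floor (y + 1 / 2))%:~R.

Lemma wrap_le (y : R) : `|wrap y| <= 1 / 2.
Proof.
have /andP[] := floor_itv (y + 1 / 2); rewrite intrD /wrap => h1 h2.
by rewrite ler_norml; apply/andP; split; lra.
Qed.

(** The cosine sees the normalized frequency difference only modulo 1, so it may be wrapped into the
    range of [cos_le_quadratic]. *)
Lemma node_gap_ge (k j : 'I_K) :
  (2 * wrap ((f k - f j) / Fs) ^+ 2)%:C%C <= `|1 - z k * (z j)^*| ^+ 2.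
Proof.
rewrite sqr_norm_one_sub_node lecR; apply: one_sub_polar_sqr_ge.
- by rewrite expR_ge0 expR_le1 /=; have := d_ge0 k; have := d_ge0 j; lra.
- set y := (f k - f j) / Fs.
  rewrite -(@cosD2pi_int R _ (- Num.floor (y + 1 / 2))) mulrNz.
  have -> : 2 * pi * y + 2 * pi * - (Num.floor (y + 1 / 2))%:~R = 2 * pi * wrap y.
    by rewrite /wrap; ring.
  exact/cos_le_quadratic/wrap_le.
- exact: cos_geN1.
Qed.

(** The wrapped differences [t j] are [dl]-separated from 0 and from each other. Those of each sign
    contribute at most [2 / dl^2] to the sum of [1 / t^2], and [4 / (2 t^2) = 2 / t^2] doubles the
    total. *)
Lemma node_row_sum (k : 'I_K) :
  \sum_(j | j != k) 4 / `|1 - z k * (z j)^*| ^+ 2 <= (8 / dl ^+ 2)%:C%C.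
Proof.
pose t j := wrap ((f k - f j) / Fs).
have tk j : j != k -> dl <= `|t j|.
  move=> jk; have := sep k j (- Num.floor ((f k - f j) / Fs + 1 / 2)).
  by rewrite mulrNz eq_sym; apply.
have tij i j : i != j -> dl <= `|t i - t j|.
  move=> ij; rewrite distrC.
  have := sep i j (Num.floor ((f k - f i) / Fs + 1 / 2) - Num.floor ((f k - f j) / Fs + 1 / 2)) ij.
  by rewrite /t /wrap intrB; congr (_ <= `| _ |); ring.
apply: (@le_trans _ _ (\sum_(j | j != k) (2 * (t j ^+ 2)^-1)%:C%C)).
  apply: ler_sum => j jk.
  have tn0 : t j != 0 by rewrite -normr_gt0; apply: lt_le_trans (tk j jk).
  have t0 : 0 < t j ^+ 2 by rewrite exprn_even_gt0.
  have -> : 2 * (t j ^+ 2)^-1 = 4 / (2 * t j ^+ 2) :> R by field.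
  rewrite rmorphM fmorphV rmorph_nat ler_pM2l // lef_pV2 ?node_gap_ge //.
    rewrite posrE; apply: lt_le_trans (node_gap_ge k j).
    by rewrite -[0](rmorph0 (real_complex R)) ltcR; rewrite -/(t j); lra.
  by rewrite posrE -[0](rmorph0 (real_complex R)) ltcR; lra.
rewrite -rmorph_sum lecR -mulr_sumr.
have -> : 8 / dl ^+ 2 = 2 * (2 / dl ^+ 2 + 2 / dl ^+ 2) by lra.
rewrite ler_pM2l // (bigID (fun j => 0 < t j)) /=.
apply: lerD.
  apply: sum_invr_sqr_separated => // [i /andP[ik t0]|i j _ _]; last exact: tij.
  by have := tk i ik; rewrite gtr0_norm.
under eq_bigr do rewrite -sqrrN.
apply: (sum_invr_sqr_separated _ _ _ (fun j => - t j)) => // [i /andP[ik t0]|i j _ _ ij].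
  by have := tk i ik; rewrite ler0_norm // leNgt.
by rewrite opprK addrC distrC tij // eq_sym.
Qed.

Lemma node_mul_neq1 (k j : 'I_K) : k != j -> z k * (z j)^* != 1.
Proof.
move=> kj; rewrite eq_sym -subr_eq0 -normr_eq0 -sqrf_eq0 gt_eqF //.
apply: lt_le_trans (node_gap_ge k j).
rewrite -[0](rmorph0 (real_complex R)) ltcR pmulr_rgt0 // exprn_even_gt0 //= -normr_gt0.
apply: lt_le_trans dl_gt0 _.
have := sep k j (- Num.floor ((f k - f j) / Fs + 1 / 2)) kj.
by rewrite mulrNz.
Qed.

Lemma expsum_blocks_close (H M : nat) (x : 'I_K -> R[i]) :
  `|\sum_(h < H) \sum_(m < M) `|expsum z x (h + m)| ^+ 2 -
    \sum_k `|x k| ^+ 2 * ((\sum_(h < H) expR (- (2 * d k)) ^+ h) *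
                          (\sum_(m < M) expR (- (2 * d k)) ^+ m))%:C%C| <=
  (8 / dl ^+ 2)%:C%C * \sum_k `|x k| ^+ 2.
Proof.
have e : \sum_k `|x k| ^+ 2 * ((\sum_(h < H) (`|z k| ^+ 2) ^+ h) *
    (\sum_(m < M) (`|z k| ^+ 2) ^+ m)) =
  \sum_k `|x k| ^+ 2 * ((\sum_(h < H) expR (- (2 * d k)) ^+ h) *
    (\sum_(m < M) expR (- (2 * d k)) ^+ m))%:C%C.
  apply: eq_bigr => k _; rewrite sqr_normc_node rmorphM !rmorph_sum.
  by congr (_ * (_ * _)); apply: eq_bigr => i _; rewrite rmorphXn.
rewrite -e; apply: sum_expsum_blocks_close => //.
- by move=> k; exact: norm_node_le1.
- exact: node_mul_neq1.
- exact: node_row_sum.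
Qed.

(** The order on [R[i]] is partial; realness lets the bound on the modulus be split into two
    inequalities. *)
Lemma diagonal_real (H M : nat) (x : 'I_K -> R[i]) :
  \sum_(h < H) \sum_(m < M) `|expsum z x (h + m)| ^+ 2 -
    \sum_k `|x k| ^+ 2 * ((\sum_(h < H) expR (- (2 * d k)) ^+ h) *
                          (\sum_(m < M) expR (- (2 * d k)) ^+ m))%:C%C \is Num.real.
Proof.
apply: realB; apply: ger0_real.
  by do 2 (apply: sumr_ge0 => ? _); rewrite exprn_ge0.
apply: sumr_ge0 => k _; rewrite mulr_ge0 ?exprn_ge0 // ler0c.
by rewrite mulr_ge0 // sumr_ge0 // => ? _; rewrite exprn_ge0 // expR_ge0.
Qed.

Variables (D : R) (N P : nat).
Hypotheses (d_le : forall k, d k <= D).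

(** Blocks [[h, h + N - P)] with [h <= P] stay inside [[0, N)]. Here [H + M - 2 = N - 1], so with
    [s = 2 d_k] the diagonal factor is exactly [1 - d_k (N - 1)]. *)
Lemma frame_lower (x : 'I_K -> R[i]) : (P <= N)%N -> (0 < N)%N ->
  (P.+1%:R * (N%:R - P%:R) * (1 - D * (N%:R - 1)) - 8 / dl ^+ 2)%:C%C * \sum_k `|x k| ^+ 2 <=
  P.+1%:R * \sum_(l < N) `|expsum z x l| ^+ 2.
Proof.
move=> PN N0.
apply: (@le_trans _ _ (\sum_(h < P.+1) \sum_(m < N - P) `|expsum z x (h + m)| ^+ 2)); last first.
  rewrite mul_natr_sum; apply: ler_sum => h _.
  apply: (ler_sum_shift _ (fun l => `|expsum z x l| ^+ 2)) => [l|]; first exact: exprn_ge0.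
  by have := ltn_ord h; lia.
have := expsum_blocks_close P.+1 (N - P) x.
rewrite real_ler_distl ?diagonal_real // => /andP[+ _]; apply: le_trans.
rewrite rmorphB mulrBl lerD2r // mulr_sumr; apply: ler_sum => k _.
rewrite mulrC ler_wpM2l ?exprn_ge0 // lecR.
apply: le_trans (geometric_product_ge _ _ (2 * d k) _ _ _); last first.
  by move=> n; rewrite -expRM_natr; apply: le_trans (expR_ge1Dx _); lra.
rewrite natrB // -(natr1 P).
apply: ler_wpM2l.
  by rewrite mulr_ge0 ?subr_ge0 ?ler_nat // addr_ge0.
have N1 : 1 <= N%:R :> R by rewrite ler1n.
by have := d_le k; nra.
Qed.

Lemma frame_upper (x : 'I_K -> R[i]) :
  P.+1%:R * \sum_(l < N) `|expsum z x l| ^+ 2 <=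
  ((P.+1%:R * (N%:R + P%:R) + 8 / dl ^+ 2) * expR (2 * D * P%:R))%:C%C * \sum_k `|x k| ^+ 2.
Proof.
(* The reindexing [x k = y k * z k ^+ P] shifts the rows by [P], so that the blocks
   that overlap [[0, N)] on the left involve only nonnegative powers. *)
pose y k := x k / z k ^+ P.
have xy l : expsum z x l = expsum z y (P + l).
  by apply: eq_bigr => k _; rewrite /y exprD mulrA divfK // expf_neq0 // node_neq0.
apply: (@le_trans _ _ (\sum_(h < P.+1) \sum_(m < N + P) `|expsum z y (h + m)| ^+ 2)).
  rewrite mul_natr_sum; apply: ler_sum => h _.
  have hP := ltn_ord h.
  (* Row [l] for [x] is row [P + l] for [y], at position [P - h + l < N + P] of block [h]. *)
  rewrite (eq_bigr (fun l : 'I_N => `|expsum z y (h + ((P - h) + l))%N| ^+ 2)); last first.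
    by move=> l _; rewrite xy; congr (`|expsum _ _ _| ^+ 2); lia.
  apply: (ler_sum_shift _ (fun l => `|expsum z y (h + l)| ^+ 2)) => [l|]; first exact: exprn_ge0.
  by lia.
have := expsum_blocks_close P.+1 (N + P) y.
rewrite real_ler_distl ?diagonal_real // => /andP[_ +].
move=> /le_trans; apply.
apply: (@le_trans _ _ ((P.+1%:R * (N%:R + P%:R) + 8 / dl ^+ 2)%:C%C * \sum_k `|y k| ^+ 2)).
  rewrite rmorphD [leRHS]mulrDl lerD2r mulr_sumr; apply: ler_sum => k _.
  rewrite mulrC ler_wpM2r ?exprn_ge0 // lecR -natrD.
  have g n : 0 <= \sum_(i < n) expR (- (2 * d k)) ^+ i <= n%:R.
    apply/andP; split; first by apply: sumr_ge0 => i _; rewrite exprn_ge0 ?expR_ge0.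
    rewrite -[leRHS]mulr1 [leRHS]mul_natr_sum; apply: ler_sum => i _.
    by rewrite exprn_ile1 ?expR_ge0 // expR_le1; have := d_ge0 k; lra.
  have /andP[a1 a2] := g P.+1; have /andP[b1 b2] := g (N + P)%N.
  exact: ler_pM.
rewrite [X in _ <= X * _]rmorphM -[leRHS]mulrA ler_wpM2l //.
  by rewrite ler0c addr_ge0 ?mulr_ge0 ?divr_ge0 ?exprn_ge0 ?addr_ge0 // invr_ge0 sqr_ge0.
(* The price of the reindexing: [|y k|^2 = |x k|^2 exp (2 d_k P)]. *)
rewrite mulr_sumr; apply: ler_sum => k _.
rewrite /y normrM normfV normrX exprMn exprVn -exprM mulnC exprM sqr_normc_node mulrC.
rewrite ler_wpM2r ?exprn_ge0 // -rmorphXn -fmorphV lecR -expRM_natr -expRN ler_expR.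
have P0 : 0 <= P%:R :> R by [].
by have := d_le k; nra.
Qed.

End Frame.

(** * From frame bounds to singular values *)

Section SingularValues.
Variables (R : realType) (m n : nat) (A : 'M[R[i]]_(m, n)) (L U : R).
Hypotheses (n_gt0 : (0 < n)%N) (L_gt0 : 0 < L).
Hypothesis frame : forall x : 'I_n -> R[i],
  L%:C%C * \sum_k `|x k| ^+ 2 <= \sum_l `|\sum_k x k * A l k| ^+ 2 <=
  U%:C%C * \sum_k `|x k| ^+ 2.

Lemma mulmx_adjmx_diag (p : nat) (v : 'rV[R[i]]_p) :
  (v *m adjmx v) 0 0 = \sum_k `|v 0 k| ^+ 2.
Proof. by rewrite mxE; apply: eq_bigr => k _; rewrite !mxE sqr_normc. Qed.

Lemma adjmxM (p q r : nat) (B : 'M[R[i]]_(p, q)) (D : 'M[R[i]]_(q, r)) :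
  adjmx (B *m D) = adjmx D *m adjmx B.
Proof. by rewrite /adjmx trmx_mul map_mxM. Qed.

Lemma adjmxK (p q : nat) (B : 'M[R[i]]_(p, q)) : adjmx (adjmx B) = B.
Proof. by apply/matrixP => i j; rewrite !mxE conjcK. Qed.

(** Eigenvectors are row vectors here; conjugation turns [A x] into [v *m adjmx A] without changing
    norms. *)
Lemma frame_row (v : 'rV[R[i]]_n) :
  L%:C%C * \sum_k `|v 0 k| ^+ 2 <= \sum_l `|(v *m adjmx A) 0 l| ^+ 2 <=
  U%:C%C * \sum_k `|v 0 k| ^+ 2.
Proof.
have := frame (fun k => conjc (v 0 k)).
have -> : \sum_k `|conjc (v 0 k)| ^+ 2 = \sum_k `|v 0 k| ^+ 2.
  by apply: eq_bigr => k _; rewrite normcJ.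
have -> // : \sum_l `|\sum_k conjc (v 0 k) * A l k| ^+ 2 = \sum_l `|(v *m adjmx A) 0 l| ^+ 2.
apply: eq_bigr => l _; rewrite -[in LHS]normcJ rmorph_sum mxE; congr (`|_| ^+ 2).
by apply: eq_bigr => k _; rewrite rmorphM /= conjcK !mxE.
Qed.

Lemma sum_norm_gt0 (v : 'rV[R[i]]_n) : v != 0 -> 0 < \sum_k `|v 0 k| ^+ 2.
Proof.
move=> /rV0Pn[k vk]; rewrite (bigD1 k) //= ltr_wpDr ?exprn_gt0 ?normr_gt0 //.
by apply: sumr_ge0 => j _; rewrite exprn_ge0.
Qed.

(** If [m < n], [adjmx A] kills a nonzero row, against the lower bound. This selects the branch of
    [sq_singular_values]. *)
Lemma frame_leq : (n <= m)%N.
Proof.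
rewrite leqNgt; apply/negP => mn.
have : kermx (adjmx A) != 0.
  rewrite kermx_eq0 /row_free; apply/negP => /eqP e.
  by have := rank_leq_col (adjmx A); rewrite e leqNgt mn.
move=> /rowV0Pn[v /sub_kermxP vA v0].
have /andP[+ _] := frame_row v; rewrite vA.
rewrite [X in _ <= X]big1; last by move=> l _; rewrite mxE normr0 expr0n.
have L0 : 0 < L%:C%C by rewrite -[0](rmorph0 (real_complex R)) ltcR.
by rewrite (pmulr_rle0 _ L0) lt_geF // sum_norm_gt0.
Qed.

(** Rayleigh quotient: an eigenvector [v] satisfies [a |v|^2 = |v *m adjmx A|^2]. *)
Lemma gram_eigenvalue_between (a : R[i]) :
  eigenvalue (adjmx A *m A) a -> L%:C%C <= a <= U%:C%C.
Proof.
move=> /eigenvalueP[v va v0].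
have S0 := sum_norm_gt0 v v0.
have e : a * \sum_k `|v 0 k| ^+ 2 = \sum_l `|(v *m adjmx A) 0 l| ^+ 2.
  rewrite -!mulmx_adjmx_diag adjmxM adjmxK mulmxA -(mulmxA v) va.
  by rewrite -scalemxAl [RHS]mxE.
have := frame_row v; rewrite -e.
by rewrite !(ler_pM2r S0).
Qed.

Lemma sq_singular_values_between (lam : R) :
  sq_singular_values A lam -> L <= lam <= U.
Proof.
rewrite /sq_singular_values frame_leq /= => /gram_eigenvalue_between.
by rewrite !lecR.
Qed.

(** [inf] and [sup] are meaningful only on a nonempty set. Algebraic closedness yields an
    eigenvalue, and [L <= a] in the order of [R[i]] makes it real. *)
Lemma sq_singular_values_nonempty : nonempty (sq_singular_values A).
Proof.
have [a ea] := eigenvalue_closed (adjmx A *m A) n_gt0.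
have /andP[La _] := gram_eigenvalue_between a ea.
have a0 : 0 <= a by apply: le_trans La; rewrite ler0c ltW.
rewrite /sq_singular_values frame_leq; exists (complex.Re a) => /=.
by rewrite RRe_real // ger0_real.
Qed.

Lemma sigma_min_sqr_ge : L <= sigma_min A ^+ 2.
Proof.
have h : L <= inf (sq_singular_values A).
  apply: lb_le_inf; first exact: sq_singular_values_nonempty.
  by move=> lam /sq_singular_values_between/andP[].
by rewrite /sigma_min sqr_sqrtr // (le_trans (ltW L_gt0)).
Qed.

Lemma sigma_max_sqr_le : sigma_max A ^+ 2 <= U.
Proof.
have [lam hlam] := sq_singular_values_nonempty.
have ub : ubound (sq_singular_values A) U.
  by move=> l /sq_singular_values_between/andP[].
have h : sup (sq_singular_values A) <= U.
  by apply: ge_sup => //; exists lam.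
have h0 : lam <= sup (sq_singular_values A).
  by apply: ub_le_sup => //; exists U.
have /andP[l0 _] := sq_singular_values_between lam hlam.
by rewrite /sigma_max sqr_sqrtr // (le_trans (ltW L_gt0)) // (le_trans l0).
Qed.

Lemma cond_number_le : cond_number A <= Num.sqrt (U / L).
Proof.
have m0 : 0 <= sigma_min A by exact: sqrtr_ge0.
have M0 : 0 <= sigma_max A by exact: sqrtr_ge0.
have h1 := sigma_min_sqr_ge; have h2 := sigma_max_sqr_le.
have m1 : 0 < sigma_min A ^+ 2 by exact: lt_le_trans h1.
rewrite /cond_number -[leLHS]ger0_norm ?divr_ge0 // -sqrtr_sqr ler_wsqrtr //.
rewrite expr_div_n; apply: ler_pM => //; rewrite ?invr_ge0 ?sqr_ge0 //.
by rewrite lef_pV2.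
Qed.

End SingularValues.

(** * Separation and the error budget *)

Lemma min_sep_le (R : realType) (Fs : R) (K : nat) (f : 'I_K -> R) (k j : 'I_K) (n : int) :
  k != j -> min_sep Fs f <= `|f k - f j + n%:~R * Fs|.
Proof.
move=> kj; apply: ge_inf; last by exists k, j, n.
by exists 0 => x [a [b [c [_ ->]]]].
Qed.

Lemma expR_le_inv (R : realType) (x : R) : x < 1 -> expR x <= (1 - x)^-1.
Proof.
move=> x1; rewrite -[expR x]invrK lef_pV2 ?posrE ?invr_gt0 ?expR_gt0 ?subr_gt0 //.
by rewrite -expRN; exact: expR_ge1Dx.
Qed.

(** Here [n = N - 1] and [q = Fs / delta]. As [q < P + 1], the Schur error per shift is at most
    [8 q]; shortening the blocks costs at most [P <= q] more, in all [9 q <= c]. *)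
Lemma lower_budget (R : realType) (q n c D : R) (P : nat) :
  1 <= q -> P%:R <= q -> q < P%:R + 1 -> 21 * q <= c -> 0 <= D -> 0 < n ->
  c < n * (1 - D * n) ->
  P.+1%:R * (n * (1 - D * n) - c) <=
  P.+1%:R * (n + 1 - P%:R) * (1 - D * n) - 8 * q ^+ 2.
Proof.
rewrite -(natr1 P); have : 0 <= P%:R :> R by [].
set p : R := P%:R => p0 q1 pq qp c21 D0 n0 cn.
have Dn0 : 0 <= D * n by rewrite mulr_ge0 // ltW.
have e0 : 0 < 1 - D * n by rewrite -(pmulr_rgt0 _ n0); lra.
apply: (@le_trans _ _ ((p + 1) * ((n + 1 - p) * (1 - D * n) - 8 * q))); last by nra.
apply: ler_wpM2l; first by lra.
have := mulr_ge0 p0 Dn0; nra.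
Qed.

(** Per shift the first factor is at most [n + 10 q]. From [D n < 1] the exponential is at most
    [n / (n - 2 q)]. What remains is [12 q n + 2 q c <= c n], which follows from [c < n] and
    [21 q <= c]. *)
Lemma upper_budget (R : realType) (q n c D : R) (P : nat) :
  1 <= q -> P%:R <= q -> q < P%:R + 1 -> 21 * q <= c -> 0 <= D -> 0 < n ->
  c < n * (1 - D * n) ->
  (P.+1%:R * (n + 1 + P%:R) + 8 * q ^+ 2) * expR (2 * D * P%:R) <= P.+1%:R * (n + c).
Proof.
rewrite -(natr1 P); have : 0 <= P%:R :> R by [].
set p : R := P%:R => p0 q1 pq qp c21 D0 n0 cn.
have Dn0 : 0 <= D * n by rewrite mulr_ge0 // ltW.
have e0 : 0 < 1 - D * n by rewrite -(pmulr_rgt0 _ n0); lra.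
have nc : c < n by have := mulr_ge0 (ltW n0) Dn0; lra.
have dq : D * p * n <= q by nra.
have dp : 2 * D * p * n <= 2 * q by lra.
have dp' : 2 * D * p <= 2 * q / n by rewrite ler_pdivlMr.
have qn : 2 * q / n < 1 by rewrite ltr_pdivrMr //; lra.
have E1 : expR (2 * D * p) <= n / (n - 2 * q).
  apply: le_trans (expR_le_inv _ _ (le_lt_trans dp' qn)) _.
  have -> : n / (n - 2 * q) = (1 - 2 * q / n)^-1 by field; apply/andP; split; lra.
  by rewrite lef_pV2 ?posrE ?subr_gt0 ?(le_lt_trans dp') // lerD2l lerN2.
apply: (@le_trans _ _ (((p + 1) * (n + 1 + p + 8 * q)) * (n / (n - 2 * q)))).
  by apply: ler_pM; rewrite ?expR_ge0 //; nra.
rewrite -mulrA ler_wpM2l ?addr_ge0 // mulrA ler_pdivrMr; last by lra.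
have h : n + 1 + p + 8 * q <= n + 10 * q by lra.
apply: le_trans (ler_wpM2r (ltW n0) h) _.
nra.
Qed.

Lemma lower_rescale (R : rcfType) (a L A : R) (S X : R[i]) :
  0 < a -> 0 <= S -> a * L <= A -> A%:C%C * S <= a%:C%C * X -> L%:C%C * S <= X.
Proof.
move=> a0 S0 aL AX.
have ac : 0 < a%:C%C by rewrite -[0](rmorph0 (real_complex R)) ltcR.
rewrite -(ler_pM2l ac) mulrA -rmorphM.
by apply: le_trans AX; rewrite ler_wpM2r // lecR.
Qed.

Lemma upper_rescale (R : rcfType) (a U A : R) (S X : R[i]) :
  0 < a -> 0 <= S -> A <= a * U -> a%:C%C * X <= A%:C%C * S -> X <= U%:C%C * S.
Proof.
move=> a0 S0 aU AX.
have ac : 0 < a%:C%C by rewrite -[0](rmorph0 (real_complex R)) ltcR.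
rewrite -(ler_pM2l ac) mulrA -rmorphM.
by apply: le_trans AX _; rewrite ler_wpM2r // lecR.
Qed.

(** * Choice of the number of shifts and conclusion *)

Theorem theorem2 (R : realType) (Fs : R) (N K : nat)
    (d f : 'I_K -> R) :
  0 < Fs -> (2 <= N)%N -> (2 <= K)%N ->
  (forall k, 0 <= d k) ->
  (forall k, 0 <= f k < Fs) ->
  dmax d < 1 / (N.-1)%:R ->
  min_sep Fs f > 84 * Fs / (pi * (N.-1)%:R * (1 - dmax d * (N.-1)%:R)) ->
  let V := vandermonde N (fun k => node Fs (d k) (f k)) in
  let c := 84 * Fs / (pi * min_sep Fs f) in
  [/\ sigma_min V ^+ 2 >= (N.-1)%:R * (1 - dmax d * (N.-1)%:R) - c,
      sigma_max V ^+ 2 <= (N.-1)%:R + c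
    & cond_number V <= Num.sqrt (((N.-1)%:R + c) /
                                 ((N.-1)%:R * (1 - dmax d * (N.-1)%:R) - c))].
Proof.
move=> Fs0 N2 K2 d0 fFs Dn dsep V c.
set D := dmax d in Dn dsep *; set n : R := (N.-1)%:R in Dn dsep *.
set s := min_sep Fs f in dsep c *.
have n0 : 0 < n by rewrite ltr0n; lia.
have NE : N%:R = n + 1 :> R by rewrite natr1 prednK //; lia.
have dD k : d k <= D by apply: le_bigmax.
have k0 : (0 < K)%N by lia.
have D0 : 0 <= D by apply: le_trans (dD (Ordinal k0)).
have Dn1 : D * n < 1 by rewrite -ltr_pdivlMr.
have p0 := @pi_gt0 R.
have p4 : pi < 4 :> R by have := @pihalf_lt2 R; lra.
have s0 : 0 < s.
  apply: le_lt_trans dsep; apply: divr_ge0; first by lra.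
  by rewrite !mulr_ge0 //; lra.
(* Two distinct indices with shift 0 bound the separation, which gives [q >= 1]. *)
have sFs : s <= Fs.
  have k01 : Ordinal k0 != Ordinal K2 by [].
  apply: le_trans (@min_sep_le R Fs K f _ _ 0 k01) _; rewrite mul0r addr0.
  have /andP[a1 a2] := fFs (Ordinal k0); have /andP[b1 b2] := fFs (Ordinal K2).
  by rewrite ler_norml; apply/andP; split; lra.
(* About [q] shifts balance the change of block length, [P], against the Schur error
   [8 q^2 / (P + 1)]. *)
pose q := Fs / s; pose P := Num.truncn q.
have q1 : 1 <= q by rewrite ler_pdivlMr // mul1r.
have /andP[Pq qP] : P%:R <= q < P.+1%:R by apply: truncn_itv; lra.
rewrite -natr1 in qP.
have cq : c = 84 / pi * q by rewrite /c /q; field; apply/andP; split; lra.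
have c21 : 21 * q <= c.
  rewrite cq ler_pM2r; last by lra.
  by rewrite ler_pdivlMr //; lra.
have cn : c < n * (1 - D * n).
  move: dsep; rewrite /c ltr_pdivrMr; last by rewrite !mulr_gt0 // subr_gt0.
  rewrite ltr_pdivrMr ?mulr_gt0 //; lra.
have dl0 : 0 < s / Fs by rewrite divr_gt0.
have sep (k j : 'I_K) (i : int) : k != j -> s / Fs <= `|(f k - f j) / Fs + i%:~R|.
  move=> kj; rewrite ler_pdivrMr //.
  have -> : (f k - f j) / Fs + i%:~R = (f k - f j + i%:~R * Fs) / Fs by field; lra.
  by rewrite normrM normfV (gtr0_norm Fs0) divfK ?gt_eqF // min_sep_le.
have dlE : 8 / (s / Fs) ^+ 2 = 8 * q ^+ 2 by rewrite /q; field; apply/andP; split; lra.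
(* From [P <= q <= c < n]. *)
have PN : (P <= N)%N by rewrite -(ler_nat R) NE; nra.
have P10 : 0 < P.+1%:R :> R by [].
have L0 : 0 < n * (1 - D * n) - c by lra.
have VE (x : 'I_K -> R[i]) : \sum_l `|\sum_k x k * V l k| ^+ 2 =
    \sum_(l < N) `|expsum (fun k => node Fs (d k) (f k)) x l| ^+ 2.
  by apply: eq_bigr => l _; congr (`|_| ^+ 2); apply: eq_bigr => k _; rewrite mxE.
have frame (x : 'I_K -> R[i]) :
  (n * (1 - D * n) - c)%:C%C * \sum_k `|x k| ^+ 2 <= \sum_l `|\sum_k x k * V l k| ^+ 2 <=
  (n + c)%:C%C * \sum_k `|x k| ^+ 2.
  rewrite VE.
  have S0 : 0 <= \sum_k `|x k| ^+ 2 by apply: sumr_ge0 => k _; rewrite exprn_ge0.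
  have Pc : P.+1%:R = (P.+1%:R)%:C%C :> R[i] by rewrite rmorph_nat.
  have lb := frame_lower _ _ _ _ _ _ d0 dl0 sep D N P dD x PN (ltnW N2).
  have ub := frame_upper _ _ _ _ _ _ d0 dl0 sep D N P dD x.
  rewrite Pc dlE NE in lb; rewrite Pc dlE NE in ub.
  apply/andP; split.
    apply: (lower_rescale _ _ _ _ _ _ P10 S0 _ lb).
    by rewrite addrK; apply: lower_budget.
  apply: (upper_rescale _ _ _ _ _ _ P10 S0 _ ub).
  exact: upper_budget.
split.
- exact: (sigma_min_sqr_ge _ _ _ _ _ _ k0 L0 frame).
- exact: (sigma_max_sqr_le _ _ _ _ _ _ k0 L0 frame).
- exact: (cond_number_le _ _ _ _ _ _ k0 L0 frame).
Qed.
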